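(* Let $n=2k+1$ with $k\ge1$ and let $A_n$ be the connected anti-regular graph on $n$ vertices. For a real number $\lambda\notin\{0,-1\}$, $\lambda$ is an eigenvalue of $A_n$ if and only if, setting $\theta=\arccos\left(\frac{1-2\lambda-2\lambda^2}{2\lambda(\lambda+1)}\right)$ (in particular the argument lies in $[-1,1]$), one has $\sin(k\theta)\ne0$ and \[\frac{2-\lambda^2}{\lambda(\lambda+1)}=\frac{\sin((k-1)\theta)}{\sin(k\theta)}.\]
   Context: A simple graph is anti-regular if exactly two of its vertices have the same degree. For each $n\ge2$, $A_n$ denotes the unique (up to isomorphism) connected anti-regular graph on $n$ vertices; for $n$ odd it is the threshold graph with creation sequence $(0,0,1,0,1,\dots,0,1)$, where a $1$ means the new vertex is joined to all previous vertices and a $0$ means it is added isolated. Eigenvalues are those of the adjacency matrix. $\arccos:[-1,1]\to[0,\pi]$. *)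

(* Defs.v *)
From mathcomp Require Import all_boot all_order all_algebra.
From mathcomp Require Import all_classical all_reals all_analysis.

Set Implicit Arguments.
Unset Strict Implicit.
Unset Printing Implicit Defensive.

Import Order.TTheory GRing.Theory Num.Theory.

Local Open Scope ring_scope.

Definition simple_graph (T : finType) (e : rel T) : Prop :=
  symmetric e /\ irreflexive e.

Definition connected_graph (T : finType) (e : rel T) : Prop :=
  forall u v : T, connect e u v.

Definition degree (T : finType) (e : rel T) (v : T) : nat :=
  #|[set w | e v w]|.

(* [set u; v] is the only two-element set of vertices of equal degree. *)
Definition anti_regular (T : finType) (e : rel T) : Prop :=
  exists u v : T,
    [/\ u != v, degree e u = degree e v &
        forall x y : T, x != y -> degree e x = degree e y ->
          [set x; y]%SET = [set u; v]%SET].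

Definition adjacency_matrix (R : pzSemiRingType) (n : nat) (e : rel 'I_n) :
    'M[R]_n :=
  \matrix_(i, j) (e i j)%:R.

(* [A_n] is only determined up to isomorphism: this says that [e] is a copy of
   it with vertex set ['I_n]. *)
Definition connected_anti_regular_graph (n : nat) (e : rel 'I_n) : Prop :=
  [/\ simple_graph e, connected_graph e & anti_regular e].

(* Main.v *)
Require Import Defs.
From mathcomp Require Import all_boot all_order all_algebra.
From mathcomp Require Import all_classical all_reals all_analysis.
From mathcomp Require Import fintype finset zify ring lra.
Import Order.TTheory GRing.Theory Num.Theory.

(* In a connected anti-regular graph, two distinct vertices are adjacent iff their
   degrees add up to at least [n].  This relabels the graph as the threshold graph
   in which [i <> j] are adjacent iff [maxn i j] is even.  There, the eigenvector
   equation becomes a two-term linear recursion on partial sums of the entries,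
   and [lambda] is an eigenvalue iff one component of it ends at [0].  Two steps of
   the recursion have determinant [1] and trace [- 2 x], so up to sign that
   component is a combination of [sin (j theta)] and [sin ((j - 1) theta)] divided
   by [sin theta].  For [x] outside [-1 < x < 1], sign and monotonicity arguments
   show that it never vanishes. *)

Set Implicit Arguments.
Unset Strict Implicit.
Unset Printing Implicit Defensive.

(** * Degrees in a connected anti-regular graph *)

Lemma degree_lt_card (T : finType) (e : rel T) (w : T) :
  irreflexive e -> degree e w < #|T|.
Proof.
move=> irr; rewrite /degree -cardsT; apply: proper_card.
by apply/properP; split; [exact: subsetT | exists w; rewrite ?inE ?irr].
Qed.

Lemma connected_degree_gt0 (T : finType) (e : rel T) (w : T) :
  connected_graph e -> 1 < #|T| -> 0 < degree e w.
Proof.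
move=> conn T_gt1.
have [z zw] : exists z, z != w.
  have /card_gt0P [z] : 0 < #|[set~ w]| by rewrite cardsC1; lia.
  by rewrite !inE; exists z.
have /connectP [[|y p] /= pth last_p] := conn w z.
  by rewrite last_p eqxx in zw.
case/andP: pth => ewy _.
by apply/card_gt0P; exists y; rewrite inE.
Qed.

Section AntiRegularDegrees.

Context (T : finType) (e : rel T) (u v : T) (n : nat).
Hypothesis cardT : #|T| = n.
Hypothesis e_irr : irreflexive e.
Hypothesis e_conn : connected_graph e.
Hypothesis uv : u != v.
Hypothesis deg_inj : forall x y, x != y -> degree e x = degree e y ->
  [set x; y]%SET = [set u; v]%SET.

Local Notation d := (degree e).

Lemma degree_bounds w : 0 < d w < n.
Proof.
rewrite -cardT degree_lt_card // andbT; apply: connected_degree_gt0 => //.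
by rewrite -cardsT (cardsD1 u) (cardsD1 v) !inE eq_sym uv.
Qed.

Lemma degree_inj_off x y : x != u -> y != u -> d x = d y -> x = y.
Proof.
move=> xu yu dxy; apply/eqP/negPn/negP => xy.
have := deg_inj xy dxy => /setP /(_ u).
by rewrite !inE eqxx eq_sym (negPf xu) eq_sym (negPf yu).
Qed.

(* Moving one of the two repeated degrees to [0] makes the degrees a bijection
   onto [0, n). *)
Lemma degree_rank_subproof w : (if w == u then 0 else d w) < n.
Proof. by have := degree_bounds w; case: eqP => _; lia. Qed.

Definition degree_rank (w : T) : 'I_n := Ordinal (degree_rank_subproof w).

Lemma degree_rankE w : degree_rank w = (if w == u then 0 else d w) :> nat.
Proof. by []. Qed.

Lemma degree_rank_inj : injective degree_rank.
Proof.
move=> x y /(congr1 (@nat_of_ord _)); rewrite !degree_rankE.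
case: (eqVneq x u) => [->|xu]; case: (eqVneq y u) => [->|yu] //.
- by have := degree_bounds y; lia.
- by have := degree_bounds x; lia.
exact: degree_inj_off.
Qed.

Lemma degree_rank_bij : bijective degree_rank.
Proof.
by apply: inj_card_bij; [exact: degree_rank_inj | rewrite card_ord cardT].
Qed.

Lemma degree_surj j : 0 < j < n -> exists w, d w = j.
Proof.
move=> /andP[j0 jn]; have [g _ gK] := degree_rank_bij.
exists (g (Ordinal jn)).
have := congr1 (@nat_of_ord _) (gK (Ordinal jn)); rewrite degree_rankE /=.
by case: eqVneq => // _ Ej; rewrite -Ej in j0.
Qed.

(** [degree_rank] takes each value below [j] once: on the vertices of degree below [j] and on [u],
    which is a new one exactly when [j <= d u]. *)
Lemma card_degree_lt j : 0 < j <= n ->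
  #|[set w | d w < j]| + (j <= d u) = j.
Proof.
move=> /andP[j0 jn].
have -> : (j <= d u) = (u \notin [set w | d w < j]) by rewrite inE -leqNgt.
rewrite addnC -cardsU1.
have -> : u |: [set w | d w < j] = degree_rank @^-1: [set i : 'I_n | i < j].
  apply/setP=> w; rewrite !inE degree_rankE.
  by case: eqVneq => //= _; rewrite j0.
rewrite on_card_preimset; last exact: onW_bij degree_rank_bij.
have -> : [set i : 'I_n | i < j] = [set widen_ord jn i | i : 'I_j].
  apply/setP=> i; rewrite !inE; apply/idP/imsetP => [ij|[i' _ ->]]; last first.
    by rewrite /=.
  by exists (Ordinal ij) => //; apply: val_inj.
rewrite card_imset ?card_ord // => a b /(congr1 val) /= ab; exact: val_inj.
Qed.

Lemma card_degree_ge j : 0 < j <= n ->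
  #|[set w | j <= d w]| + j = n + (j <= d u).
Proof.
move=> hj; have := card_degree_lt hj.
have -> : [set w | j <= d w] = ~: [set w | d w < j].
  by apply/setP=> w; rewrite !inE -leqNgt.
have := cardsC [set w | d w < j]; rewrite cardT; lia.
Qed.

Hypothesis e_sym : symmetric e.

(* The degrees are settled from both ends inwards: a vertex of degree [n - j]
   misses all vertices of degree [< j], hence is adjacent to all the others, and
   then a vertex of degree [j] has no room for neighbours of degree [< n - j].
   Counting also keeps the repeated degree strictly inside at each step. *)
Lemma adjacency_threshold_step j : j.*2 < n ->
  [/\ j <= d u, d u + j < n &
      forall w z, w != z -> d w <= j \/ n <= d w + j ->
        e w z = (n <= d w + d z)].
Proof.
elim: j => [|j IH] jn.
  split=> // [|w z _]; first by have := degree_bounds u; lia.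
  by have := degree_bounds w; lia.
have {IH} [ju jun IH] := IH ltac:(lia).
have Nsub p : d p = n - j.+1 ->
    [set z | e p z] \subset [set z | j < d z] :\ p.
  move=> dp; apply/subsetP=> z; rewrite !inE => epz.
  have zp : z != p by apply: contraTneq epz => ->; rewrite e_irr.
  rewrite zp /= ltnNge; apply/negP => zj.
  have := IH z p zp (or_introl zj); rewrite e_sym epz; lia.
have cD p : d p = n - j.+1 ->
    #|[set z | j < d z] :\ p| = n - j.+1 + (j < d u) - 1.
  move=> dp; have := @card_degree_ge j.+1 ltac:(lia).
  rewrite (cardsD1 p) inE (_ : j < d p) /=; last by lia.
  by case: (j < d u) => /=; lia.
(* Were [d u <= j], [cD] would leave [n - j - 2] places for the [n - j - 1] neighbours of [p]. With
   this excluded, the inclusion [Nsub] is an equality. *)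
have ju' : j < d u.
  have [p dp] := @degree_surj (n - j.+1) ltac:(lia).
  have := subset_leq_card (Nsub _ dp).
  rewrite cD // -/(degree e p) dp; lia.
have high p z : p != z -> d p = n - j.+1 -> e p z = (n <= d p + d z).
  move=> pz dp.
  have /eqP/setP/(_ z) : [set z | e p z] == [set z | j < d z] :\ p.
    rewrite eqEcard Nsub //= cD // -/(degree e p) dp ju'; lia.
  by rewrite !inE eq_sym pz /= => ->; rewrite dp; apply/idP/idP; lia.
have high' p z : p != z -> n <= d p + j.+1 -> e p z = (n <= d p + d z).
  move=> pz; case: (ltnP (n - j.+1) (d p)) => [dp _|dp dp'].
    by apply: IH => //; right; lia.
  by apply: high => //; lia.
have Msub w : d w = j.+1 -> [set z | n - j.+1 <= d z] \subset [set z | e w z].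
  move=> dw; apply/subsetP=> z; rewrite !inE => dz.
  have zw : z != w by apply: contraTneq dz => ->; lia.
  by rewrite e_sym high' //; lia.
have cM := @card_degree_ge (n - j.+1) ltac:(lia).
(* [cM] counts [j + 1] vertices of degree at least [n - j - 1], plus one if [n - j - 1 <= d u]; [w]
   has only [j + 1] neighbours to accommodate them. *)
have jun' : d u + j.+1 < n.
  have [w dw] := @degree_surj j.+1 ltac:(lia).
  have := subset_leq_card (Msub _ dw).
  rewrite -/(degree e w) dw; lia.
split=> // w z wz [dw|]; last exact: high'.
case: (ltnP (d w) j.+1) => dw'; first by apply: IH => //; left; lia.
have {}dw : d w = j.+1 by lia.
have /eqP/setP/(_ z) : [set z | n - j.+1 <= d z] == [set z | e w z].
  rewrite eqEcard Msub //= -/(degree e w) dw; lia.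
by rewrite !inE => <-; apply/idP/idP; lia.
Qed.

(** At [j = k] the two bounds pin down [d u], and each degree is either [<= k] or [>= n - k], so
    every pair is covered. *)
Lemma adjacency_threshold k : n = k.*2.+1 ->
  d u = k /\ forall w z, w != z -> e w z = (n <= d w + d z).
Proof.
move=> nk; have [|ku kun E] := @adjacency_threshold_step k; first by lia.
split=> [|w z wz]; first lia.
by apply: E => //; lia.
Qed.

End AntiRegularDegrees.

(** * Relabelling as the threshold graph with creation sequence 0, 0, 1, 0, 1, ..., 0, 1 *)

Definition threshold_adj (i j : nat) : bool := (i != j) && ~~ odd (maxn i j).

Lemma anti_regular_labelling (T : finType) (e : rel T) k :
  #|T| = k.*2.+1 -> simple_graph e -> connected_graph e -> anti_regular e ->
  exists2 p : T -> 'I_(k.*2.+1), bijective p &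
    forall x y, e x y = threshold_adj (p x) (p y).
Proof.
move=> nk [e_sym e_irr] e_conn [u [v [uv _ dinj]]].
have [du E] := adjacency_threshold nk e_irr e_conn uv dinj e_sym (erefl _).
have dn := degree_bounds nk e_irr e_conn uv.
(* In the threshold graph on [0, ..., 2k] the label [2m] has degree [k + m] and [2m + 1] has degree
   [k - m]; labels [0] and [1] share degree [k], and [u] takes [0]. *)
pose g w := if w == u then 0
  else if k < degree e w then (degree e w - k).*2
  else (k - degree e w).*2.+1.
have gn w : g w < k.*2.+1.
  by rewrite /g; case: eqP => // _; have := dn w; case: ifP; lia.
exists (fun w => Ordinal (gn w)).
  apply: inj_card_bij; last by rewrite card_ord nk.
  move=> x y /(congr1 val) /=; rewrite /g.
  case: (eqVneq x u) => [->|xu]; case: (eqVneq y u) => [->|yu] //.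
  - by case: ifP; lia.
  - by case: ifP; lia.
  move=> gxy; apply: (degree_inj_off dinj xu yu).
  by move: gxy; do 2!case: ifP; lia.
move=> x y; rewrite /threshold_adj /=.
have [->|xy] := eqVneq x y; first by rewrite e_irr eqxx.
rewrite E // /g.
case: (eqVneq x u) xy => [->|xu]; case: (eqVneq y u) => [->|yu] // xy;
  rewrite ?eqxx // ?du.
- by case: ifP; lia.
- by case: ifP; lia.
have dxy : degree e x <> degree e y.
  by move=> dxy; rewrite (degree_inj_off dinj xu yu dxy) eqxx in xy.
by do 2!case: ifP; lia.
Qed.

(** * Eigenvectors of the threshold graph *)

Local Open Scope ring_scope.

(* Along an eigenvector [y] of the threshold adjacency for [lambda], normalised
   to have even entries of sum [1], the second component at [i] is the sum
   of the [y j] with [j >= i] even, and the first one exceeds it by the sum of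
   all [y j] with [j < i]. *)
Fixpoint eigen_sums (F : fieldType) (lambda : F) (i : nat) : F * F :=
  if i is j.+1 then
    let: (a, b) := eigen_sums lambda j in
    if odd j then (a + b / lambda, b) else (a, b - a / (lambda + 1))
  else (1, 1).

Section ThresholdEigenvectors.

Context (F : fieldType) (lambda : F) (N : nat).
Hypothesis lambda_neq0 : lambda != 0.
Hypothesis lambda1_neq0 : lambda + 1 != 0.
Hypothesis N_gt0 : (0 < N)%N.

(** The equation at [i] solved for the entry at [i]; for even [i] the sum [a] includes that entry,
    whence [lambda + 1]. *)
Definition eigen_entry (i : nat) : F :=
  let: (a, b) := eigen_sums lambda i in
  if odd i then b / lambda else a / (lambda + 1).

Lemma sum_threshold_adj (y : nat -> F) j : (j < N)%N ->
  \sum_(0 <= i < N | threshold_adj i j) y i =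
  (if odd j then 0 else \sum_(0 <= i < j) y i) +
  \sum_(j.+1 <= i < N | ~~ odd i) y i.
Proof.
move=> jN; rewrite (@big_cat_nat _ _ _ j) //=; last exact: ltnW.
congr (_ + _).
  case: ifP => oj.
    rewrite big_nat_cond big1 // => i /andP[/andP[_ ij]].
    by rewrite /threshold_adj (maxn_idPr (ltnW ij)) oj andbF.
  rewrite big_nat_cond [RHS]big_nat_cond; apply: eq_bigl => i.
  have [/andP[_ ij] /=|//] := boolP (0 <= i < j)%N.
  by rewrite /threshold_adj neq_ltn ij (maxn_idPr (ltnW ij)) oj.
rewrite big_ltn_cond // /threshold_adj eqxx /=.
rewrite big_nat_cond [RHS]big_nat_cond; apply: eq_bigl => i.
have [/andP[ij _] /=|//] := boolP (j < i < N)%N.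
by rewrite neq_ltn ij orbT (maxn_idPl (ltnW ij)).
Qed.

(** The equation at [i] determines [y i] from the two sums at [i], and these then give the sums at
    [i + 1]; so [c] determines the whole eigenvector. *)
Lemma eigenvector_sums (y : nat -> F) :
  (forall j, (j < N)%N ->
     \sum_(0 <= i < N | threshold_adj i j) y i = lambda * y j) ->
  let c := \sum_(0 <= m < N | ~~ odd m) y m in
  forall i, (i <= N)%N ->
    [/\ \sum_(0 <= m < i) y m + \sum_(i <= m < N | ~~ odd m) y m =
          c * (eigen_sums lambda i).1,
        \sum_(i <= m < N | ~~ odd m) y m = c * (eigen_sums lambda i).2 &
        (i < N)%N -> y i = c * eigen_entry i].
Proof.
move=> yE c i iN.
suff [HU HT] : \sum_(0 <= m < i) y m + \sum_(i <= m < N | ~~ odd m) y m =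
          c * (eigen_sums lambda i).1 /\
        \sum_(i <= m < N | ~~ odd m) y m = c * (eigen_sums lambda i).2.
  split=> // {}iN; move: (yE i iN); rewrite sum_threshold_adj //.
  move: HU HT; rewrite /eigen_entry (@big_ltn_cond _ _ _ i) //.
  case: (eigen_sums lambda i) => a b /=; case: (odd i) => /= HU HT Hy.
    apply: (mulfI lambda_neq0); rewrite -Hy add0r HT; field.
    by rewrite lambda_neq0.
  apply: (mulfI lambda1_neq0); rewrite mulrDl -Hy mul1r.
  rewrite -addrA [X in _ + X = _]addrC HU; field.
  by rewrite lambda1_neq0.
elim: i iN => [|i IH] iN; first by rewrite big_nil add0r /= mulr1.
have {IH} [HU HT] := IH (ltnW iN).
move: (yE i iN) HU HT; rewrite sum_threshold_adj // big_nat_recr //=.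
rewrite (@big_ltn_cond _ _ _ i) //.
set S := \sum_(0 <= m < i) _; set T := \sum_(_ <= m < _ | _) _.
case: (eigen_sums lambda i) => a b /=; case: (odd i) => /= Hy HU HT.
  split=> //; rewrite addrAC HU mulrDr; congr (_ + _).
  apply: (mulfI lambda_neq0); rewrite -Hy add0r HT; field.
  by rewrite lambda_neq0.
split; first by rewrite -addrA HU.
apply: (addrI (y i)); rewrite HT.
have -> : y i = c * (a / (lambda + 1)); last by ring.
apply: (mulfI lambda1_neq0); rewrite mulrDl -Hy mul1r.
rewrite -addrA [X in _ + X = _]addrC HU; field.
by rewrite lambda1_neq0.
Qed.

Lemma eigen_entry_sums : (eigen_sums lambda N).2 = 0 ->
  forall i, (i <= N)%N ->
    \sum_(0 <= m < i) eigen_entry m + (eigen_sums lambda i).2 =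
      (eigen_sums lambda i).1 /\
    \sum_(i <= m < N | ~~ odd m) eigen_entry m = (eigen_sums lambda i).2.
Proof.
move=> TN0 i iN; split.
  elim: i iN => [|i IH] iN; first by rewrite big_nil add0r.
  have {IH} := IH (ltnW iN); rewrite big_nat_recr //= {3}/eigen_entry.
  case: (eigen_sums lambda i) => a b /=; case: (odd i) => /= <-; ring.
(* Downward induction from [N], where the tail is empty and [TN0] supplies the base. *)
rewrite -(subKn iN); elim: (N - i)%N => [|d IH].
  by rewrite subn0 TN0 big_geq.
case: (ltnP d N) => dN; last first.
  by move: IH; rewrite (_ : N - d.+1 = N - d)%N //; lia.
have E : (N - d = (N - d.+1).+1)%N by lia.
rewrite E in IH; rewrite big_ltn_cond; last by lia.
rewrite {}IH /= /eigen_entry.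
by case: (eigen_sums _ _) => a b; case: (odd _) => //=; ring.
Qed.

(** At [N] the tail sum is empty, so [c] times the last second component is [0], and [c = 0] would
    annihilate every entry. *)
Lemma threshold_eigenvectorP :
  (exists2 y : nat -> F, exists2 i, (i < N)%N & y i != 0 &
     forall j, (j < N)%N ->
       \sum_(0 <= i < N | threshold_adj i j) y i = lambda * y j) <->
  (eigen_sums lambda N).2 = 0.
Proof.
split=> [[y [i iN yi0] yE] | TN0].
  have E := eigenvector_sums yE.
  have [_ _ /(_ iN) yiE] := E i (ltnW iN).
  have [_ TN _] := E N (leqnn N).
  move: TN; rewrite [LHS]big_geq // => /esym/eqP.
  rewrite mulf_eq0 => /orP[/eqP c0|/eqP->] //.
  by rewrite yiE c0 mul0r eqxx in yi0.
exists eigen_entry.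
  by exists 0%N => //; rewrite /eigen_entry /= div1r invr_neq0.
move=> j jN; rewrite sum_threshold_adj //.
have [_ ->] := eigen_entry_sums TN0 jN.
have [+ _] := eigen_entry_sums TN0 (ltnW jN).
rewrite [eigen_entry j]/eigen_entry /=.
case: (eigen_sums lambda j) => a b /=; case: (odd j) => /= Ha.
  by field; rewrite lambda_neq0.
by rewrite addrA Ha; field; rewrite lambda1_neq0.
Qed.

End ThresholdEigenvectors.

Lemma eigenvalue_labelled_threshold (F : fieldType) (lambda : F) N
    (e : rel 'I_N.+1) (p : 'I_N.+1 -> 'I_N.+1) :
  lambda != 0 -> lambda + 1 != 0 -> bijective p ->
  (forall x y, e x y = threshold_adj (p x) (p y)) ->
  eigenvalue (adjacency_matrix F e) lambda <-> (eigen_sums lambda N.+1).2 = 0.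
Proof.
move=> l0 l1 [q pK qK] eE.
rewrite -threshold_eigenvectorP //.
have qE w x : e (q w) (q x) = threshold_adj w x by rewrite eE !qK.
have q_bij : bijective q by exists p.
split=> [/eigenvalueP[v vE v0] | [y [i iN yi0] yE]].
  exists (fun m => v 0 (q (inord m))).
    have /rV0Pn[i vi0] := v0.
    by exists (p i) => //; rewrite inord_val pK.
  move=> j jN; move/rowP: vE => /(_ (q (inord j))); rewrite !mxE => <-.
  rewrite big_mkord [RHS](reindex q (onW_bij _ q_bij)) big_mkcond /=.
  apply: eq_bigr => i _.
  rewrite !mxE qE inord_val inordK //.
  by case: ifP => _; rewrite ?mulr1 ?mulr0.
apply/eigenvalueP; exists (\row_i y (p i)).
  apply/rowP=> j; rewrite !mxE -yE // big_mkord.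
  rewrite (reindex q (onW_bij _ q_bij)) [RHS]big_mkcond.
  apply: eq_bigr => m _; rewrite !mxE eE qK.
  by case: ifP => _; rewrite ?mulr1 ?mulr0.
apply/rV0Pn; exists (q (Ordinal iN)).
by rewrite mxE qK.
Qed.

(** * Signs of the final sum and the range of [x] *)

Section CharacteristicSequence.

Context (R : realFieldType) (lambda : R).
Hypothesis lambda_neq0 : lambda != 0.
Hypothesis lambda1_neq0 : lambda + 1 != 0.

Let mu := lambda * (lambda + 1).
Let x := (1 - 2 * lambda - 2 * lambda ^+ 2) / (2 * lambda * (lambda + 1)).

(* The sign makes the recurrence the Chebyshev one in [x]. *)
Definition signed_sum (j : nat) : R :=
  (-1) ^+ j * (eigen_sums lambda j.*2.+1).2.

Lemma signed_sum_eq0 j :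
  (signed_sum j = 0) <-> ((eigen_sums lambda j.*2.+1).2 = 0).
Proof.
split=> [/eqP|H]; last by rewrite /signed_sum H mulr0.
by rewrite mulf_eq0 signr_eq0 => /eqP.
Qed.

Lemma signed_sum0 : signed_sum 0 = lambda / (lambda + 1).
Proof. by rewrite /signed_sum /=; field. Qed.

Lemma signed_sum1 : signed_sum 1 = (2 - lambda ^+ 2) / (lambda + 1) ^+ 2.
Proof.
by rewrite /signed_sum /=; field; rewrite lambda_neq0 lambda1_neq0.
Qed.

Lemma signed_sum_rec j :
  signed_sum j.+2 = 2 * x * signed_sum j.+1 - signed_sum j.
Proof.
rewrite /signed_sum !doubleS /= !exprS odd_double /=.
case: (eigen_sums lambda j.*2) => a b /=; rewrite /x; field.
by rewrite lambda_neq0 lambda1_neq0.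
Qed.

(** Thus [mu < 0] means [x < -1], [0 < mu <= 1 / 4] means [x >= 1], and [mu > 1 / 4] means
    [-1 < x < 1]. *)
Lemma mu_xE : 2 * mu * (x + 1) = 1.
Proof. by rewrite /mu /x; field; rewrite lambda_neq0 lambda1_neq0. Qed.

(** Here [-1 < lambda < 0], so each update pushes its component further from [0]. *)
Lemma eigen_sums_signs : mu < 0 -> forall j,
  0 < (eigen_sums lambda j.*2.+1).1 /\ (eigen_sums lambda j.*2.+1).2 < 0.
Proof.
move=> mu_lt0.
have l0 : lambda < 0 by rewrite /mu in mu_lt0; nra.
have l1 : 0 < lambda + 1 by rewrite /mu in mu_lt0; nra.
have E : 1 - 1 / (lambda + 1) = lambda / (lambda + 1) by field.
elim=> [|j]; first by rewrite /= E ltr01 pmulr_llt0 ?invr_gt0.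
rewrite doubleS /= odd_double /=.
case: (eigen_sums lambda j.*2) => a b /= [a0 b0].
have a1 : 0 < a + (b - a / (lambda + 1)) / lambda.
  by rewrite addr_gt0 // nmulr_rgt0 // invr_lt0.
by split=> //; rewrite subr_lt0 (lt_trans b0) // divr_gt0.
Qed.

(** Here [x >= 1], so by the recurrence the increments of a positive increasing sequence never
    shrink. *)
Lemma signed_sum_increasing : 0 < mu -> mu <= 1 / 4 -> forall j,
  0 < signed_sum j < signed_sum j.+1.
Proof.
move=> mu_gt0 mu_le.
have x1 : 1 <= x by have := mu_xE; nra.
elim=> [|j /andP[s0 s1]]; last first.
  apply/andP; split; first exact: lt_trans s1.
  by rewrite signed_sum_rec; nra.
rewrite signed_sum0 signed_sum1.
have E0 : lambda / (lambda + 1) = mu / (lambda + 1) ^+ 2.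
  by rewrite /mu; field.
have q0 : 0 < (lambda + 1) ^+ 2 by rewrite exprn_even_gt0.
rewrite E0 divr_gt0 //= ltr_pM2r ?invr_gt0 //.
(* These rough bounds from [mu <= 1 / 4] give [lambda ^+ 2 < 25 / 16], hence [mu < 2 - lambda ^+ 2],
   which compares the first two terms. *)
have l2 : -5 / 4 < lambda < 1.
  by move: mu_gt0 mu_le; rewrite /mu => ? ?; apply/andP; split; nra.
by case/andP: l2 => ? ?; rewrite /mu in mu_gt0 mu_le *; nra.
Qed.

Lemma signed_sum_root_range k : signed_sum k = 0 -> -1 < x < 1.
Proof.
move=> sk0; have mux := mu_xE.
have mu_n0 : mu != 0 by rewrite mulf_neq0.
case: (ltrgtP mu 0) mu_n0 => // mu_s _.
  have [_] := eigen_sums_signs mu_s k.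
  by move/signed_sum_eq0: sk0 => ->; rewrite ltxx.
have [mu_le|mu_gt] := lerP mu (1 / 4).
  by have := signed_sum_increasing mu_s mu_le k; rewrite sk0 ltxx.
by apply/andP; split; nra.
Qed.

End CharacteristicSequence.

(** * Sines of multiples and the Chebyshev recurrence *)

Lemma sin_natmul_rec (R : realType) (theta : R) j :
  sin (j.+2%:R * theta) =
  2 * cos theta * sin (j.+1%:R * theta) - sin (j%:R * theta).
Proof.
have -> : j.+2%:R * theta = j.+1%:R * theta + theta by rewrite -natr1; ring.
have -> : j%:R * theta = j.+1%:R * theta - theta.
  by rewrite -[j.+1%:R]natr1; ring.
rewrite sinD sinB; ring.
Qed.

Lemma sin_natmul_eq0 (R : realType) (theta : R) j :
  sin theta = 0 -> sin (j%:R * theta) = 0.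
Proof.
move=> s0; elim: j => [|j IH]; first by rewrite mul0r sin0.
by rewrite -natr1 mulrDl mul1r sinD IH s0 mul0r mulr0 addr0.
Qed.

(** Both sides obey the same recurrence. The factor [sin theta] is kept on the left so that
    [sin theta = 0] is allowed. *)
Lemma chebyshev_recurrence_sin (R : realType) (theta : R) (s : nat -> R) :
  (forall j, s j.+2 = 2 * cos theta * s j.+1 - s j) ->
  forall j, s j.+1 * sin theta =
    s 1%N * sin (j.+1%:R * theta) - s 0%N * sin (j%:R * theta).
Proof.
move=> sE j.
suff [] : s j.+1 * sin theta =
    s 1%N * sin (j.+1%:R * theta) - s 0%N * sin (j%:R * theta) /\
  s j.+2 * sin theta =
    s 1%N * sin (j.+2%:R * theta) - s 0%N * sin (j.+1%:R * theta) by [].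
elim: j => [|j [IH1 IH2]]; split=> //.
- by rewrite mul0r sin0 mul1r; ring.
- rewrite sE sin_natmul_rec mul0r sin0 mul1r; ring.
transitivity (2 * cos theta * (s j.+2 * sin theta) - s j.+1 * sin theta).
  by rewrite sE; ring.
rewrite IH1 IH2 (sin_natmul_rec _ j.+1) (sin_natmul_rec _ j); ring.
Qed.

Lemma signed_sum_eq0_sinP (R : realType) (lambda : R) (k : nat) :
  lambda != 0 -> lambda + 1 != 0 -> (0 < k)%N ->
  let x := (1 - 2 * lambda - 2 * lambda ^+ 2) / (2 * lambda * (lambda + 1)) in
  let theta := acos x in
  signed_sum lambda k = 0 <->
  [/\ -1 <= x <= 1,
      sin (k%:R * theta) <> 0 &
      (2 - lambda ^+ 2) / (lambda * (lambda + 1)) =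
        sin ((k%:R - 1) * theta) / sin (k%:R * theta)].
Proof.
move=> l0 l1; case: k => // k _ x theta.
have -> : k.+1%:R - 1 = k%:R :> R by rewrite -natr1 addrK.
(* The factor [lambda / (lambda + 1)] is term [0] of the sequence, and the left side of the target
   equation is the ratio of term [1] to term [0]. *)
have key : -1 <= x <= 1 ->
    signed_sum lambda k.+1 * sin theta =
    lambda / (lambda + 1) *
      ((2 - lambda ^+ 2) / (lambda * (lambda + 1)) * sin (k.+1%:R * theta)
       - sin (k%:R * theta)).
  move=> x_range; have cosx : cos theta = x by apply: acosK.
  rewrite (chebyshev_recurrence_sin (theta := theta)); last first.
    by move=> j; rewrite cosx; exact: signed_sum_rec.
  rewrite signed_sum0 // signed_sum1 //; field.
  by rewrite l0 l1.
split=> [s0 | [x_range sk0 E]]; last first.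
  have /eqP := key x_range.
  rewrite E divfK; last exact/eqP.
  rewrite subrr mulr0 mulf_eq0 => /orP[/eqP //|/eqP st0].
  (* [sin theta = 0] would make the sine of every multiple vanish, contrary to [sk0]. *)
  by case: sk0; apply: sin_natmul_eq0.
have /andP[x1 x2] := signed_sum_root_range l0 l1 s0.
have x_range : -1 <= x <= 1 by rewrite !ltW.
have st0 : sin theta != 0.
  rewrite sin_acos // sqrtr_eq0 -ltNge subr_gt0; rewrite -/x in x1 x2; nra.
have /esym/eqP := key x_range.
rewrite s0 mul0r mulf_eq0 mulf_eq0 invr_eq0 (negPf l0) (negPf l1) /= subr_eq0.
move=> /eqP E.
(* Otherwise [E] makes two consecutive sines vanish, and the subtraction formula gives
   [sin theta = 0]. *)
have sk0 : sin (k.+1%:R * theta) != 0.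
  apply/eqP => sk0; case/eqP: st0.
  have -> : theta = k.+1%:R * theta - k%:R * theta by rewrite -natr1; ring.
  by rewrite sinB -E sk0 mulr0 !mul0r mulr0 subr0.
by split=> //; [exact/eqP | rewrite -E mulfK].
Qed.

Theorem theorem7p1 (R : realType) (n k : nat)
  (hn : n = (2 * k + 1)%N) (hk : (1 <= k)%N)
  (e : rel 'I_n) (he : connected_anti_regular_graph e)
  (lambda : R) (h0 : lambda <> 0) (h1 : lambda <> -1) :
  let x : R :=
    (1 - 2 * lambda - 2 * lambda ^+ 2) / (2 * lambda * (lambda + 1)) in
  let theta : R := acos x in
  eigenvalue (adjacency_matrix R e) lambda <->
  [/\ -1 <= x <= 1,
      sin (k%:R * theta) <> 0 &
      (2 - lambda ^+ 2) / (lambda * (lambda + 1)) =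
        sin ((k%:R - 1) * theta) / sin (k%:R * theta)].
Proof.
have {}hn : n = k.*2.+1 by lia.
subst n.
have l0 : lambda != 0 by apply/eqP.
have l1 : lambda + 1 != 0 by rewrite addr_eq0; apply/eqP.
have [e_simple e_conn e_anti] := he.
have [p p_bij eE] := anti_regular_labelling (card_ord _) e_simple e_conn e_anti.
move=> x theta.
apply: iff_trans (eigenvalue_labelled_threshold l0 l1 p_bij eE) _.
apply: iff_trans (iff_sym (signed_sum_eq0 lambda k)) _.
exact: signed_sum_eq0_sinP.
Qed.
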